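(* (1) For every odd $n\ge 3$ there is a tight irreducible subcube partition $F$ of $\{0,1\}^n$ with $\delta(F)=\frac{n-3}{2}$. (2) For $n=4$ there is a tight irreducible subcube partition $F$ of $\{0,1\}^4$ with $\delta(F)=0$. (3) For every even $n\ge 6$ there is a tight irreducible subcube partition $F$ of $\{0,1\}^n$ with $\delta(F)=\frac{n-2}{2}$.
   Context: Subcubes of $\{0,1\}^n$ are identified with words in $\{0,1,*\}^n$; the dimension of a subcube is its number of $*$s. A subcube partition is a partition of $\{0,1\}^n$ into subcubes; it is irreducible if no subset $G$ with $1<|G|<|F|$ has a union that is a subcube, and tight if for every coordinate $i$ some subcube $s$ has $s_i\ne*$. $\delta(F)$ denotes the minimum dimension of a subcube in $F$. *)

(* Defs.v *)
From mathcomp Require Import all_boot.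

Set Implicit Arguments.
Unset Strict Implicit.
Unset Printing Implicit Defensive.

Definition point (n : nat) := {ffun 'I_n -> bool}.

(* Words in {0,1,*}^n: None stands for *, Some b for the bit b. *)
Definition subcube (n : nat) := {ffun 'I_n -> option bool}.

Definition cube n (s : subcube n) : {set point n} :=
  [set x : point n | [forall i, (s i == None) || (s i == Some (x i))]].

Definition dim n (s : subcube n) : nat := #|[set i | s i == None]|.

(* [cube] is injective with nonempty values, so the blocks [cube @: F]
   correspond one-to-one to the words of [F]. *)
Definition subcube_partition n (F : {set subcube n}) : Prop :=
  partition (@cube n @: F) [set: point n].

Definition irreducible n (F : {set subcube n}) : Prop :=
  ~ exists G : {set subcube n},
      [/\ G \subset F, 1 < #|G| < #|F|
        & exists t : subcube n, \bigcup_(s in G) cube s = cube t].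

Definition tight n (F : {set subcube n}) : Prop :=
  forall i : 'I_n, exists2 s, s \in F & s i != None.

(* Since dim s <= n, the default n does not affect the minimum over a
   nonempty F. *)
Definition delta n (F : {set subcube n}) : nat := \big[minn/n]_(s in F) dim s.

(* Main.v *)
(** A partition of [{0,1}^n] is encoded by a set of words [F]; it is irreducible
    when every word [t] which each word of [F] either refines or clashes with
    (differs from in a fixed bit) is the full word or a member of [F].

    Two irreducible partitions [F0], [F1] sharing a word can be stacked along a
    new coordinate: shared words get a [*] there, the others the bit telling
    which partition they come from, and the result is again irreducible.
    Stacking [F] (with a dummy coordinate [y]) on top of the copy where [y] and
    the [i]-th coordinate are exchanged amounts to replacing the variable [x_i]
    by "if z then y else x_i".  Words not involving [x_i] gain two stars, the
    others gain one, so [n] grows by 2 and the minimum dimension by 1 as soon as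
    a word of minimum dimension involves [x_i].  The iteration starts from
    explicit partitions for n = 3 and n = 6. *)

Require Import Defs.
From mathcomp Require Import all_boot.
From mathcomp Require Import fingroup perm.

Set Implicit Arguments.
Unset Strict Implicit.
Unset Printing Implicit Defensive.

(** * Subcubes as words, and irreducibility in terms of words *)

Section Words.
Variable n : nat.
Implicit Types (s t : subcube n) (x : point n) (F : {set subcube n}).

Definition refines s t := [forall i, (t i == None) || (s i == t i)].

(** Word form of disjointness of the two cubes, by [common_point] and [clash_cube]. *)
Definition clash s t := [exists i, [&& s i != None, t i != None & s i != t i]].

Definition full_word : subcube n := [ffun=> None].

(** A single rewritable equation says both that [x] lies in [s] and that it lies in no other word of
    [F]. *)
Definition exact_cover F : Prop :=
  forall x, exists2 s, s \in F &
    forall s', s' \in F -> (x \in cube s') = (s' == s).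

(** When [F] is an exact cover, this says that [cube t] is a union of cubes of [F]. *)
Definition saturated F t : Prop :=
  forall s, s \in F -> refines s t || clash s t.

Definition word_irreducible F : Prop :=
  forall t, saturated F t -> t \in F \/ t = full_word.

Lemma in_cubeP s x :
  reflect (forall i, s i = None \/ s i = Some (x i)) (x \in cube s).
Proof.
rewrite inE; apply: (iffP forallP) => h i.
  by case/orP: (h i) => /eqP; [left | right].
by case: (h i) => ->; rewrite eqxx ?orbT.
Qed.

Lemma refinesP s t :
  reflect (forall i, t i = None \/ s i = t i) (refines s t).
Proof.
apply: (iffP forallP) => h i.
  by case/orP: (h i) => /eqP; [left | right].
by case: (h i) => ->; rewrite eqxx ?orbT.
Qed.

Lemma in_full_word x : x \in cube full_word.
Proof. by apply/in_cubeP => i; left; rewrite ffunE. Qed.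

Lemma common_point s t : ~~ clash s t ->
  exists2 x, x \in cube s & x \in cube t.
Proof.
move=> /existsPn h.
exists [ffun i => if s i is Some b then b
                  else if t i is Some b then b else false].
  by apply/in_cubeP => i; rewrite ffunE; case: (s i); [right | left].
apply/in_cubeP => i; move: (h i); rewrite ffunE.
case: (s i) (t i) => [a|] [b|] //= h'; try by [left | right].
by right; move/negbNE/eqP: h' => ->.
Qed.

Lemma clashxx s : clash s s = false.
Proof. by apply/existsP => -[i]; rewrite eqxx !andbF. Qed.

Lemma clash_full s : clash s full_word = false.
Proof. by apply/existsP => -[i]; rewrite ffunE andbF. Qed.

Lemma cube_nonempty s : exists x, x \in cube s.
Proof. by have [|x] := @common_point s s; rewrite ?clashxx //; exists x. Qed.

Lemma clash_cube s t x : clash s t -> x \in cube s -> x \notin cube t.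
Proof.
case/existsP=> i /and3P[si ti neq] /in_cubeP/(_ i) hs.
apply/in_cubeP => /(_ i) ht; move: si ti neq.
by case: hs ht => -> [] ->; rewrite ?eqxx.
Qed.

Lemma cube_subset_refines s t : cube s \subset cube t -> refines s t.
Proof.
(* The point of [s] that disagrees with [t] wherever it can. *)
set x : point n := [ffun i => if s i is Some b then b
                              else if t i is Some b then ~~ b else false].
have xs : x \in cube s.
  by apply/in_cubeP => i; rewrite ffunE; case: (s i); [right | left].
move=> /subsetP/(_ _ xs)/in_cubeP h; apply/refinesP => i.
case: (h i) => [|ti]; [by left | right; move: ti; rewrite ffunE].
by case: (s i) (t i) => [a|] [b|] //= [] //; case: b.
Qed.

Lemma exact_cover_inj F s s' x : exact_cover F -> s \in F -> s' \in F ->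
  x \in cube s -> x \in cube s' -> s = s'.
Proof.
by move=> /(_ x)[u _ hu] sF s'F; rewrite !hu // => /eqP-> /eqP->.
Qed.

Lemma exact_cover_partition F : exact_cover F -> subcube_partition F.
Proof.
move=> eF; apply/and3P; split.
- rewrite eqEsubset subsetT; apply/subsetP => x _.
  have [s sF hs] := eF x; apply/bigcupP; exists (cube s).
    exact: imset_f.
  by rewrite hs.
- apply/trivIsetP => _ _ /imsetP[s sF ->] /imsetP[t tF ->].
  apply: contraR; rewrite -setI_eq0 => /set0Pn[x /setIP[xs xt]].
  by rewrite (exact_cover_inj eF sF tF xs xt).
- apply/imsetP => -[s _ /setP h]; have [x] := cube_nonempty s.
  by rewrite -h inE.
Qed.

(** If the union of [G] is [cube t], the words of [G] refine [t] and the other words of [F] are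
    disjoint from it, so [t] is saturated. Then [t \in F] forces [G] into [[set t]], and a full [t]
    forces [F \subset G]; both contradict the bounds on [#|G|]. *)
Lemma word_irreducible_irreducible F :
  exact_cover F -> word_irreducible F -> irreducible F.
Proof.
move=> eF iF [G [/subsetP GF /andP[G1 GltF] [t Gt]]].
have Gin s : s \in G -> cube s \subset cube t.
  by move=> sG; rewrite -Gt (bigcup_max s).
have Gcover x : x \in cube t -> exists2 s, s \in G & x \in cube s.
  by rewrite -Gt => /bigcupP[s]; exists s.
have [s sF|tF|t_full] := iF t.
- case: (boolP (s \in G)) => [/Gin/cube_subset_refines -> //|sG].
  apply/orP; right; apply: contraR sG => /common_point[x xs /Gcover[s' s'G xs']].
  by rewrite (exact_cover_inj eF sF (GF _ s'G) xs xs').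
- suff /subset_leq_card : G \subset [set t] by rewrite cards1 leqNgt G1.
  apply/subsetP => s sG; rewrite inE; have [x xs] := cube_nonempty s.
  by rewrite (exact_cover_inj eF (GF _ sG) tF xs) // (subsetP (Gin s sG)).
- suff /subset_leq_card : F \subset G by rewrite leqNgt GltF.
  apply/subsetP => s sF; have [x xs] := cube_nonempty s.
  have [|s' s'G xs'] := Gcover x; first by rewrite t_full in_full_word.
  by rewrite (exact_cover_inj eF sF (GF _ s'G) xs xs').
Qed.

Lemma dim_le s : dim s <= n.
Proof. by rewrite -[leqRHS]card_ord max_card. Qed.

Lemma delta_eq F d : (exists2 s, s \in F & dim s = d) ->
  (forall s, s \in F -> d <= dim s) -> delta F = d.
Proof.
case=> s sF <- dF; apply/eqP; rewrite eqn_leq; apply/andP; split.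
  rewrite /delta; elim: index_enum (mem_index_enum s) => //= u r IHr.
  rewrite inE big_cons => /predU1P[<-|/IHr h]; first by rewrite sF geq_minl.
  by case: ifP => // _; rewrite geq_min h orbT.
(* The default value [n] must be bounded below too; it is, because the claimed minimum is the
   dimension of a word. *)
rewrite /delta; elim/big_rec: _ => [|u m uF h]; first exact: dim_le.
by rewrite leq_min dF.
Qed.

End Words.

(** * Prepending a coordinate at index 0 *)

Section Cons.
Variables (T : Type) (n : nat).

Definition fcons (a : T) (f : {ffun 'I_n -> T}) : {ffun 'I_n.+1 -> T} :=
  [ffun i => if unlift ord0 i is Some j then f j else a].

Definition fbehead (f : {ffun 'I_n.+1 -> T}) : {ffun 'I_n -> T} :=
  [ffun j => f (lift ord0 j)].

Lemma fcons0 a f : fcons a f ord0 = a.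
Proof. by rewrite ffunE unlift_none. Qed.

Lemma fconsS a f j : fcons a f (lift ord0 j) = f j.
Proof. by rewrite ffunE liftK. Qed.

Lemma fconsK (f : {ffun 'I_n.+1 -> T}) : fcons (f ord0) (fbehead f) = f.
Proof.
by apply/ffunP => i; rewrite ffunE; case: unliftP => [j|] -> //; rewrite ffunE.
Qed.

Lemma fbehead_cons a f : fbehead (fcons a f) = f.
Proof. by apply/ffunP => i; rewrite ffunE fconsS. Qed.

Lemma forall_ordS (P : 'I_n.+1 -> Prop) :
  (forall i, P i) <-> P ord0 /\ forall j, P (lift ord0 j).
Proof.
split=> [h|[h0 h] i]; first by split.
by case: (unliftP ord0 i) => [j|] ->.
Qed.

End Cons.

Section ConsWords.
Variable n : nat.
Implicit Types (s t : subcube n) (x : point n) (a b : option bool).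

Lemma forallb_ordS (P : pred 'I_n.+1) :
  [forall i, P i] = P ord0 && [forall j, P (lift ord0 j)].
Proof.
apply/forallP/andP => [/forall_ordS[h0 h]|[h0 /forallP h]].
  by split=> //; apply/forallP.
by apply/forall_ordS.
Qed.

Lemma refines_cons a b s t :
  refines (fcons a s) (fcons b t) = ((b == None) || (a == b)) && refines s t.
Proof.
rewrite /refines forallb_ordS !fcons0; congr (_ && _).
by apply: eq_forallb => i; rewrite !fconsS.
Qed.

Lemma clash_cons a b s t :
  clash (fcons a s) (fcons b t) =
  [&& a != None, b != None & a != b] || clash s t.
Proof.
apply: negb_inj; rewrite negb_or !negb_exists forallb_ordS !fcons0.
by congr (_ && _); apply: eq_forallb => i; rewrite !fconsS.
Qed.

Lemma in_cube_cons a s (b : bool) x :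
  (fcons b x \in cube (fcons a s)) =
  ((a == None) || (a == Some b)) && (x \in cube s).
Proof.
rewrite !inE forallb_ordS !fcons0; congr (_ && _).
by apply: eq_forallb => i; rewrite !fconsS.
Qed.

Lemma full_word_cons : full_word n.+1 = fcons None (full_word n).
Proof. by rewrite -[LHS]fconsK ffunE; congr fcons; apply/ffunP=> i; rewrite !ffunE. Qed.

Lemma dim_cons a s : dim (fcons a s) = (a == None) + dim s.
Proof.
rewrite /dim -!sum1_card big_mkcond [in RHS]big_mkcond big_ord_recl inE fcons0.
by congr (_ + _); apply: eq_bigr => i _; rewrite !inE fconsS.
Qed.

End ConsWords.

(** * Stacking two partitions along a new coordinate *)

Section Stack.
Variables (n : nat) (F : bool -> {set subcube n}).

Definition stack : {set subcube n.+1} :=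
  [set w : subcube n.+1 | match w ord0 with
           | None => (fbehead w \in F false) && (fbehead w \in F true)
           | Some b => (fbehead w \in F b) && (fbehead w \notin F (~~ b))
           end].

Lemma in_stack_None s :
  (fcons None s \in stack) = (s \in F false) && (s \in F true).
Proof. by rewrite inE fcons0 fbehead_cons. Qed.

Lemma in_stack_Some b s :
  (fcons (Some b) s \in stack) = (s \in F b) && (s \notin F (~~ b)).
Proof. by rewrite inE fcons0 fbehead_cons. Qed.

Lemma stack_layer b s : s \in F b ->
  exists2 a, (a == None) || (a == Some b) & fcons a s \in stack.
Proof.
move=> sF; case: (boolP (s \in F (~~ b))) => sF'.
  by exists None; rewrite ?in_stack_None //; case: b sF sF' => /= -> ->.
by exists (Some b); rewrite ?eqxx ?orbT // in_stack_Some sF.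
Qed.

Lemma stack_in_layer b a s : fcons a s \in stack ->
  (a == None) || (a == Some b) -> s \in F b.
Proof.
by case: a => [c|]; rewrite ?in_stack_None ?in_stack_Some;
   case: b; try case: c => //; move/andP=> [].
Qed.

Lemma stack_exact_cover : (forall b, exact_cover (F b)) -> exact_cover stack.
Proof.
move=> eF y; rewrite -(fconsK y); move: (y ord0) (fbehead y) => b x.
have [s sF hs] := eF b x; have [a ab asF] := stack_layer sF.
exists (fcons a s) => // w; rewrite -(fconsK w).
move: (w ord0) (fbehead w) => c t tF; rewrite in_cube_cons.
case: (boolP (_ || _)) => [cb|ncb] /=.
  have tFb := stack_in_layer tF cb; rewrite hs //.
  apply/eqP/eqP => [ts|/(congr1 (@fbehead _ _))]; last by rewrite !fbehead_cons.
  (* Two words with the same tail and first letters compatible with [b] coincide: a star requires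
     the tail to be shared by the layers, a bit requires it not to be. *)
  subst t; congr fcons; case: a c ab cb asF tF => [a|] [c|] //= /eqP ab /eqP cb.
  - by rewrite ab cb.
  - case: ab => ->; rewrite in_stack_Some in_stack_None.
    by case: (b) => /andP[_ /negbTE->]; rewrite ?andbF.
  - case: cb => ->; rewrite in_stack_Some in_stack_None => /andP[h0 h1].
    by case: (b); rewrite /= ?h0 ?h1 ?andbF.
by apply/esym/eqP => /(congr1 (fun w : subcube _ => w ord0)); rewrite !fcons0 => ca;
   rewrite ca ab in ncb.
Qed.

(** Saturation passes to the tail [t] in each layer that the first letter allows. If that letter is
    a bit, every shared word clashes with [t]: so [t] is not shared, and [s0] rules out that [t] is
    full, that is, that the word is a half cube. *)
Lemma stack_irreducible s0 : s0 \in F false -> s0 \in F true ->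
  (forall b, word_irreducible (F b)) -> word_irreducible stack.
Proof.
move=> s00 s01 iF w; rewrite -(fconsK w).
move: (w ord0) (fbehead w) => a t sat.
have layer b : (a == None) || (a == Some b) -> t \in F b \/ t = full_word n.
  move=> ab; apply: iF => s sF; have [c cb csF] := stack_layer sF.
  move: (sat _ csF); rewrite refines_cons clash_cons.
  case/orP=> [/andP[_ ->] //|/orP[|->]]; last by rewrite orbT.
  (* Both first letters are compatible with the same [b], so they cannot clash. *)
  by case: a c {sat csF} ab cb => [a|] [c|] //= /eqP[->] /eqP[->]; rewrite eqxx.
case: a sat layer => [b|] sat layer.
  (* A shared word starts with a star, so it cannot refine a word starting with a bit. *)
  have shared s : s \in F false -> s \in F true -> clash s t.
    move=> h0 h1; have := sat (fcons None s).
    by rewrite in_stack_None h0 h1 refines_cons clash_cons => /(_ isT).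
  have [|tF|t_full] := layer b; first by rewrite eqxx.
    left; rewrite in_stack_Some tF; apply/negP => tF'.
    suff : clash t t by rewrite clashxx.
    by apply: shared; case: b tF tF' {sat layer}.
  by have := shared _ s00 s01; rewrite t_full clash_full.
rewrite in_stack_None full_word_cons.
have [//|->|->] := layer false; last by right.
by have [//|->|->] := layer true; [left | right].
Qed.

(** An unshared word carries a bit in the new coordinate; any old coordinate fixed in some layer
    stays fixed in the stack. *)
Lemma stack_tight : F false :\: F true != set0 ->
  (forall i, exists b, exists2 s, s \in F b & s i != None) -> tight stack.
Proof.
case/set0Pn=> s0 /setDP[s00 s01] tF; apply/forall_ordS; split.
  by exists (fcons (Some false) s0); rewrite ?in_stack_Some ?s00 // fcons0.
move=> i; have [b [s sF si]] := tF i; have [a _ asF] := stack_layer sF.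
by exists (fcons a s); rewrite ?fconsS.
Qed.

End Stack.

(** * Adding a coordinate that no word fixes *)

Section Dummy.
Variables (n : nat) (F : {set subcube n}).

Definition dummy : {set subcube n.+1} := [set fcons None s | s in F].

Lemma mem_dummy s : s \in F -> fcons None s \in dummy.
Proof. exact: imset_f. Qed.

Lemma dummy_exact_cover : exact_cover F -> exact_cover dummy.
Proof.
move=> eF y; rewrite -(fconsK y); move: (y ord0) (fbehead y) => b x.
have [s sF hs] := eF x; exists (fcons None s); first exact: mem_dummy.
move=> _ /imsetP[t tF ->]; rewrite in_cube_cons hs //.
apply/eqP/eqP => [-> //|/(congr1 (@fbehead _ _))].
by rewrite !fbehead_cons.
Qed.

(** A saturated word starting with a bit is refined by no word, so its tail would clash with every
    word of [F], including one that covers a point of the tail. *)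
Lemma dummy_irreducible :
  exact_cover F -> word_irreducible F -> word_irreducible dummy.
Proof.
move=> eF iF w; rewrite -(fconsK w); move: (w ord0) (fbehead w) => [b|] t sat.
  have [x xt] := cube_nonempty t; have [s sF hs] := eF x.
  have := sat _ (mem_dummy sF); rewrite refines_cons clash_cons /= => st.
  by have := clash_cube st (etrans (hs _ sF) (eqxx s)); rewrite xt.
have [s sF||->] := iF t.
- by have := sat _ (mem_dummy sF); rewrite refines_cons clash_cons.
- by left; apply: mem_dummy.
- by right; rewrite full_word_cons.
Qed.

End Dummy.

(** * Invariance under permutations of the coordinates *)

Section Permute.
Variables (n : nat) (p : {perm 'I_n}).
Implicit Types (s t : subcube n) (F : {set subcube n}).

Definition fperm (T : Type) (q : {perm 'I_n}) (f : {ffun 'I_n -> T}) :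
  {ffun 'I_n -> T} := [ffun i => f (q i)].

Definition permute F : {set subcube n} := [set fperm p s | s in F].

Lemma fpermK (T : Type) : cancel (@fperm T p^-1%g) (fperm p).
Proof. by move=> f; apply/ffunP => i; rewrite !ffunE permK. Qed.

Lemma fperm_inj : injective (@fperm (option bool) p).
Proof.
move=> s t /ffunP h; apply/ffunP => i.
by have := h (p^-1%g i); rewrite !ffunE permKV.
Qed.

Lemma forallb_perm (P : pred 'I_n) : [forall i, P (p i)] = [forall i, P i].
Proof.
apply/forallP/forallP => h i //.
by have := h (p^-1%g i); rewrite permKV.
Qed.

Lemma refines_perm s t : refines (fperm p s) (fperm p t) = refines s t.
Proof.
rewrite /refines -[RHS]forallb_perm.
by apply: eq_forallb => i; rewrite !ffunE.
Qed.

Lemma clash_perm s t : clash (fperm p s) (fperm p t) = clash s t.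
Proof.
apply: negb_inj; rewrite !negb_exists -[RHS]forallb_perm.
by apply: eq_forallb => i; rewrite !ffunE.
Qed.

Lemma in_cube_perm s (x : point n) : (fperm p x \in cube (fperm p s)) = (x \in cube s).
Proof.
rewrite !inE -[RHS]forallb_perm.
by apply: eq_forallb => i; rewrite !ffunE.
Qed.

Lemma dim_perm s : dim (fperm p s) = dim s.
Proof.
rewrite /dim -(card_imset _ (@perm_inj _ p)); congr #|pred_of_set _|.
apply/setP => i; rewrite -(permKV p i) mem_imset ?inE ?ffunE //.
exact: perm_inj.
Qed.

Lemma mem_permute F s : (fperm p s \in permute F) = (s \in F).
Proof. exact: mem_imset fperm_inj. Qed.

Lemma permute_exact_cover F : exact_cover F -> exact_cover (permute F).
Proof.
move=> eF y; rewrite -(fpermK y); have [s sF hs] := eF (fperm p^-1%g y).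
exists (fperm p s) => [|_ /imsetP[t tF ->]]; first by rewrite mem_permute.
by rewrite in_cube_perm hs // (inj_eq fperm_inj).
Qed.

Lemma permute_irreducible F : word_irreducible F -> word_irreducible (permute F).
Proof.
move=> iF w; rewrite -(fpermK w); move: (fperm _ w) => t sat.
have [s sF||->] := iF t; [|by left; rewrite mem_permute|right].
  by have := sat (fperm p s); rewrite mem_permute refines_perm clash_perm; apply.
by apply/ffunP => i; rewrite !ffunE.
Qed.

End Permute.

(* The last two clauses provide a coordinate to be split by [split_coord]. *)
Definition good_partition n d (F : {set subcube n}) : Prop :=
  [/\ exact_cover F, tight F, word_irreducible F,
      forall s, s \in F -> d <= dim s
    & exists i, (exists2 s, s \in F & (dim s = d) /\ (s i != None)) /\
                (exists2 s, s \in F & s i = None)].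

Lemma good_partition_spec n d (F : {set subcube n}) : good_partition d F ->
  [/\ subcube_partition F, tight F, irreducible F & delta F = d].
Proof.
case=> eF tF iF dF [i [[s sF [sd _]] _]]; split=> //.
- exact: exact_cover_partition.
- exact: word_irreducible_irreducible.
- by apply: delta_eq => //; exists s.
Qed.

(** * Splitting a coordinate: the inductive step *)

Section SplitCoord.
Variables (n d : nat) (F : {set subcube n}) (i : 'I_n).

Let swap : {perm 'I_n.+1} := tperm ord0 (lift ord0 i).

(** Index 0 is the selector [z], index 1 the dummy [y], and the old coordinate [i] moves up by two;
    the [true] layer reads [y] in place of [x_i]. *)
Definition split_coord : {set subcube n.+2} :=
  stack (fun b => if b then permute swap (dummy F) else dummy F).

Lemma fperm_swap_cons (s : subcube n) : s i = None ->
  fperm swap (fcons None s) = fcons None s.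
Proof.
move=> si; apply/ffunP => j; rewrite ffunE.
by case: tpermP => [->|->|//]; rewrite fcons0 fconsS.
Qed.

(** The swap moves the dummy star to position [i], so the words shared by the layers are exactly
    those with a star there. *)
Lemma mem_swap_dummy (s : subcube n) : s \in F ->
  (fcons None s \in permute swap (dummy F)) = (s i == None).
Proof.
move=> sF; apply/imsetP/eqP => [[_ /imsetP[t _ ->] /ffunP/(_ (lift ord0 i))]|si].
  by rewrite fconsS ffunE tpermR fcons0.
by exists (fcons None s); rewrite ?mem_dummy // fperm_swap_cons.
Qed.

(** The word [s0] is shared, which gives irreducibility; [s1] is not, which makes the selector tight
    and keeps the minimum dimension at [d.+1]. *)
Lemma split_coord_good (s1 s0 : subcube n) :
  exact_cover F -> tight F -> word_irreducible F ->
  (forall s, s \in F -> d <= dim s) ->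
  s1 \in F -> dim s1 = d -> s1 i != None -> s0 \in F -> s0 i = None ->
  good_partition d.+1 split_coord.
Proof.
move=> eF tF iF dF s1F s1d s1i s0F s0i.
have s0swap : fcons None s0 \in permute swap (dummy F).
  by rewrite mem_swap_dummy ?s0i.
have s1swap : fcons None s1 \notin permute swap (dummy F).
  by rewrite mem_swap_dummy.
split.
- apply: stack_exact_cover => -[]; last exact: dummy_exact_cover.
  exact/permute_exact_cover/dummy_exact_cover.
- apply: stack_tight.
    by apply/set0Pn; exists (fcons None s1); rewrite inE s1swap mem_dummy.
  apply/forall_ordS; split=> [|j].
    (* The [false] layer never fixes the dummy coordinate; the swapped [s1] does, because [s1] fixes
       [i]. *)
    exists true, (fperm swap (fcons None s1)).
      by rewrite mem_permute mem_dummy.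
    by rewrite ffunE tpermL fconsS.
  have [s sF sj] := tF j; exists false, (fcons None s).
    exact: mem_dummy.
  by rewrite fconsS.
- apply: (@stack_irreducible _ _ (fcons None s0)) => //; first exact: mem_dummy.
  have iD : word_irreducible (dummy F) by apply: dummy_irreducible.
  by case=> //; apply: permute_irreducible.
- move=> w; rewrite -(fconsK w); move: (w ord0) (fbehead w) => a t h.
  (* The dummy star already gives [d.+1] in both layers; the selector letter can only add to it. *)
  have dimD u : u \in dummy F -> d < dim u.
    by case/imsetP=> s sF ->; rewrite dim_cons ltnS dF.
  rewrite dim_cons; apply: leq_trans (leq_addl _ _).
  case: a h => [[]|]; rewrite ?in_stack_None ?in_stack_Some; case/andP; auto.
  by case/imsetP=> u uD -> _; rewrite dim_perm dimD.
(* The same coordinate can be split again, with the lifts of [s1] and [s0] as witnesses. *)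
- exists (lift ord0 (lift ord0 i)); split.
    exists (fcons (Some false) (fcons None s1)).
      by rewrite in_stack_Some mem_dummy.
    by rewrite !fconsS !dim_cons s1d.
  exists (fcons None (fcons None s0)); last by rewrite !fconsS.
  by rewrite in_stack_None mem_dummy.
Qed.

End SplitCoord.

(** With the size written [k.*2 + n], the successor case converts to two more coordinates, so no
    cast between word types arises. *)
Lemma good_partition_iter n d k (F : {set subcube n}) :
  good_partition d F -> exists F' : {set subcube (k.*2 + n)}, good_partition (k + d) F'.
Proof.
move=> gF; elim: k => [|k [F']]; first by exists F.
case=> eF tF iF dF [i [[s1 s1F [s1d s1i]] [s0 s0F s0i]]].
by exists (split_coord F' i); apply: split_coord_good s1F _ s1i s0F s0i.
Qed.

(** * Checking small partitions by computation *)

Section Check.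
Variable n : nat.
Implicit Types (s t w : seq (option bool)) (ws : seq (seq (option bool))).

Fixpoint seqs (T : Type) (A : seq T) k : seq (seq T) :=
  if k is k'.+1 then [seq a :: u | a <- A, u <- seqs A k'] else [:: [::]].

Lemma mem_seqs (T : eqType) (A : seq T) k u :
  size u = k -> {subset u <= A} -> u \in seqs A k.
Proof.
elim: k u => [|k IHk] [|a u] //= [su] uA.
by apply: allpairs_f; [apply: uA; rewrite mem_head |
  apply: IHk => // b bu; apply: uA; rewrite inE bu orbT].
Qed.

Definition to_word w : subcube n := [ffun i => nth None w (val i)].

Definition all_coords (P : pred nat) := all P (iota 0 n).

Definition refines_seq s t :=
  all_coords (fun i => (nth None t i == None) || (nth None s i == nth None t i)).

Definition clash_seq s t := ~~ all_coords (fun i =>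
  ~~ [&& nth None s i != None, nth None t i != None & nth None s i != nth None t i]).

Definition in_cube_seq (x : seq bool) s := all_coords (fun i =>
  (nth None s i == None) || (nth None s i == Some (nth false x i))).

Definition dim_seq s := count (fun i => nth None s i == None) (iota 0 n).

(** The clauses follow [good_partition] in order, running over all $2^n$ points and all $3^n$ words;
    the negated [all_coords] is an existential over coordinates. Lists and natural indices let
    [vm_compute] evaluate the test. *)
Definition check d ws :=
  [&& all (fun x => has (fun s => all (fun s' => in_cube_seq x s' == (s' == s)) ws) ws)
          (seqs [:: false; true] n),
      all_coords (fun i => has (fun s => nth None s i != None) ws),
      all (fun t => all (fun s => refines_seq s t || clash_seq s t) ws ==>
                    (t \in ws) || (t == nseq n None))
          (seqs [:: None; Some false; Some true] n),
      all (fun s => (size s == n) && (d <= dim_seq s)) ws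
    & ~~ all_coords (fun i =>
        ~~ (has (fun s => (dim_seq s == d) && (nth None s i != None)) ws
            && has (fun s => nth None s i == None) ws))].

Lemma all_coordsE P : all_coords P = [forall i : 'I_n, P i].
Proof.
apply/allP/forallP => [h i|h i].
  by apply: h; rewrite mem_iota add0n ltn_ord.
by rewrite mem_iota /= => lt_in; apply: (h (Ordinal lt_in)).
Qed.

Definition of_ffun (T : Type) (f : {ffun 'I_n -> T}) := [seq f i | i <- enum 'I_n].

Lemma size_of_ffun (T : Type) (f : {ffun 'I_n -> T}) : size (of_ffun f) = n.
Proof. by rewrite size_map size_enum_ord. Qed.

Lemma nth_of_ffun (T : Type) (a : T) (f : {ffun 'I_n -> T}) (i : 'I_n) :
  nth a (of_ffun f) i = f i.
Proof. by rewrite (nth_map i) ?size_enum_ord // nth_ord_enum. Qed.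

Lemma of_ffunK (t : subcube n) : to_word (of_ffun t) = t.
Proof. by apply/ffunP => i; rewrite ffunE nth_of_ffun. Qed.

Lemma refines_to_word s t : refines (to_word s) (to_word t) = refines_seq s t.
Proof. by rewrite [RHS]all_coordsE; apply: eq_forallb => i; rewrite !ffunE. Qed.

Lemma clash_to_word s t : clash (to_word s) (to_word t) = clash_seq s t.
Proof.
rewrite /clash_seq all_coordsE; apply: negb_inj; rewrite negbK negb_exists.
by apply: eq_forallb => i; rewrite !ffunE.
Qed.

Lemma in_cube_to_word (x : point n) s :
  (x \in cube (to_word s)) = in_cube_seq (of_ffun x) s.
Proof.
rewrite inE [RHS]all_coordsE; apply: eq_forallb => i.
by rewrite !ffunE nth_of_ffun.
Qed.

Lemma dim_to_word s : dim (to_word s) = dim_seq s.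
Proof.
rewrite /dim_seq -val_enum_ord count_map -size_filter enumT /dim cardE.
by congr size; apply: eq_filter => i; rewrite /= inE ffunE.
Qed.

Lemma to_word_inj s t : size s = n -> size t = n ->
  to_word s = to_word t -> s = t.
Proof.
move=> ss st /ffunP h; apply: (@eq_from_nth _ None) => [|i]; rewrite ss ?st //.
by move=> lt_in; have := h (Ordinal lt_in); rewrite !ffunE.
Qed.

Lemma check_good d ws : check d ws -> exists F : {set subcube n}, good_partition d F.
Proof.
case/and5P=> /allP cover_ws; rewrite !all_coordsE => /forallP tight_ws.
move=> /allP irr_ws /allP size_ws; rewrite negb_forall => /existsP[i].
rewrite negbK => /andP[/hasP[s1 s1_ws /andP[/eqP s1d s1i]] /hasP[s0 s0_ws /eqP s0i]].
exists [set w in [seq to_word w | w <- ws]]; split.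
- move=> x; have /cover_ws/hasP[s s_ws /allP hs] :
      of_ffun x \in seqs [:: false; true] n.
    by apply: mem_seqs (size_of_ffun x) _ => -[].
  exists (to_word s) => [|w]; rewrite inE; first exact: map_f.
  case/mapP=> s' s'_ws ->; rewrite in_cube_to_word (eqP (hs _ s'_ws)).
  (* The size test in [check] makes [to_word] injective on [ws]. *)
  apply/eqP/eqP => [-> //|]; apply: to_word_inj.
    by have /andP[/eqP] := size_ws _ s'_ws.
  by have /andP[/eqP] := size_ws _ s_ws.
- move=> j; have /hasP[s s_ws sj] := tight_ws j.
  by exists (to_word s); rewrite ?inE ?map_f // ffunE.
- move=> t; rewrite -(of_ffunK t); set u := of_ffun t => sat.
  have /irr_ws/implyP : u \in seqs [:: None; Some false; Some true] n.
    by apply: mem_seqs (size_of_ffun t) _ => -[[]|].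
  case/(_ _)/orP=> [|u_ws|/eqP u_full].
  + apply/allP => s s_ws; rewrite -refines_to_word -clash_to_word.
    by apply: sat; rewrite inE map_f.
  + by left; rewrite inE map_f.
  + by right; apply/ffunP => j; rewrite !ffunE u_full nth_nseq if_same.
- move=> w; rewrite inE => /mapP[s /size_ws/andP[_ ds] ->].
  by rewrite dim_to_word.
- exists i; split; [exists (to_word s1) | exists (to_word s0)];
    rewrite ?inE ?map_f ?ffunE ?dim_to_word //.
Qed.

End Check.

(** * Base partitions and conclusion *)

Local Notation "'O" := (Some false) (at level 0).
Local Notation "'I" := (Some true) (at level 0).
Local Notation "''*'" := (@None bool) (at level 0).

(** Two antipodal points, and the three cyclic rotations of the edge [01*] covering the other six
    vertices. *)
Lemma good_partition_3 : exists F : {set subcube 3}, good_partition 0 F.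
Proof.
apply: (@check_good _ _
  [:: [:: 'O; 'O; 'O]; [:: 'I; 'I; 'I];
      [:: 'O; 'I; '*]; [:: 'I; '*; 'O]; [:: '*; 'O; 'I]]).
by vm_compute.
Qed.

Lemma good_partition_4 : exists F : {set subcube 4}, good_partition 0 F.
Proof.
(* The partition for n = 3 stacked on its mirror image in the last coordinate. *)
apply: (@check_good _ _
  [:: [:: '*; 'O; 'I; '*];
      [:: 'O; 'O; 'O; 'O]; [:: 'O; 'I; 'I; 'I];
      [:: 'O; 'I; '*; 'O]; [:: 'O; '*; 'O; 'I];
      [:: 'I; 'O; 'O; 'I]; [:: 'I; 'I; 'I; 'O];
      [:: 'I; 'I; '*; 'I]; [:: 'I; '*; 'O; 'O]]).
by vm_compute.
Qed.

(* Found by a randomized exact-cover search. *)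
Lemma good_partition_6 : exists F : {set subcube 6}, good_partition 2 F.
Proof.
apply: (@check_good _ _
  [:: [:: 'O; '*; '*; '*; 'I; 'I]; [:: 'O; '*; 'I; 'O; '*; 'O];
      [:: 'O; '*; '*; 'I; '*; 'O]; [:: '*; '*; 'O; 'O; '*; 'O];
      [:: 'O; 'I; '*; '*; 'O; 'I]; [:: '*; 'O; '*; '*; 'O; 'I];
      [:: 'I; 'O; '*; '*; 'I; 'I]; [:: 'I; '*; 'O; 'I; '*; 'O];
      [:: 'I; 'I; 'O; '*; '*; 'I]; [:: 'I; 'O; 'I; '*; '*; 'O];
      [:: 'I; 'I; 'I; '*; '*; '*]]).
by vm_compute.
Qed.

Theorem theorem2p48 :
  [/\ forall n : nat, odd n -> 3 <= n ->
        exists F : {set subcube n},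
          [/\ subcube_partition F, tight F, irreducible F
            & delta F = (n - 3) %/ 2],
      exists F : {set subcube 4},
        [/\ subcube_partition F, tight F, irreducible F & delta F = 0]
    & forall n : nat, ~~ odd n -> 6 <= n ->
        exists F : {set subcube n},
          [/\ subcube_partition F, tight F, irreducible F
            & delta F = (n - 2) %/ 2]].
Proof.
split=> [n n_odd n3||n n_even n6].
- have [F3 /(good_partition_iter ((n - 3) %/ 2))] := good_partition_3.
  have -> : ((n - 3) %/ 2).*2 + 3 = n.
    by rewrite -muln2 divnK ?subnK // dvdn2 oddB // n_odd.
  by case=> F /good_partition_spec; rewrite addn0; exists F.
- by have [F /good_partition_spec] := good_partition_4; exists F.
(* Iterating from [good_partition_4] would give only $(n-4)/2$; starting at $n=6$ with minimum
   dimension 2 gains the missing 1. *)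
- have [F6 /(good_partition_iter ((n - 6) %/ 2))] := good_partition_6.
  have -> : ((n - 6) %/ 2).*2 + 6 = n.
    by rewrite -muln2 divnK ?subnK // dvdn2 oddB // (negbTE n_even).
  have -> : (n - 6) %/ 2 + 2 = (n - 2) %/ 2.
    by rewrite addnC -divnMDl // -[in RHS](subnKC n6).
  by case=> F /good_partition_spec; exists F.
Qed.
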